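(* Let $F$ be a non-abelian free group of finite rank, let $\iota_1,\iota_2:F\to F*F$ be the canonical inclusions, and let $\iota:F\to F*F$, $\iota(g)=\iota_1(g)\iota_2(g)$. Suppose that for all quasimorphisms $\varphi',\psi'$ of $F*F$ with $[\delta^1\varphi']\smile[\delta^1\psi']=0\in H^4_b(F*F)$ one has $[\delta^1(\varphi'\circ\iota)]\smile[\delta^1(\psi'\circ\iota)]=0\in H^4_b(F)$. Then, if $\varphi$ is in $\Sigma_{Ind}$ or is a Rolli quasimorphism of $F$, and $\psi$ is any quasimorphism of $F$, we have $[\delta^1\varphi]\smile[\delta^1\psi]=0\in H^4_b(F)$.
   Context: Bounded cohomology of a group $G$. $C^n_b(G)$ is the space of bounded functions $G^n\to\mathbb{R}$ ($C^0_b=\mathbb{R}$). The coboundary is $\delta^n f(g_1,\dots,g_{n+1})=f(g_2,\dots,g_{n+1})+\sum_{i=1}^n(-1)^i f(g_1,\dots,g_ig_{i+1},\dots,g_{n+1})+(-1)^{n+1}f(g_1,\dots,g_n)$ ($\delta^0=0$), defined also on unbounded functions; $H^n_b(G)=\ker(\delta^n|_{C^n_b})/\delta^{n-1}(C^{n-1}_b(G))$. The cup product is induced by $(f\smile f')(g_1,\dots,g_{n+m})=f(g_1,\dots,g_n)f'(g_{n+1},\dots,g_{n+m})$. For $\varphi:G\to\mathbb{R}$, $\delta^1\varphi(g,h)=\varphi(g)+\varphi(h)-\varphi(gh)$; $\varphi$ is a quasimorphism if $\delta^1\varphi$ is bounded, and then $[\delta^1\varphi]\in H^2_b(G)$. (The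 composition of a quasimorphism of $F*F$ with $\iota$ is a quasimorphism of $F$.) Words. $F$ has a fixed basis $S=\{s_1,\dots,s_n\}$; elements are reduced words; a product is reduced if there is no cancellation. $w$ is a subword of $g$ if $g=uwv$ as a reduced product; it is proper if $w\ne g$. Words $w_1,w_2$ overlap properly if, for some $i\in\{1,2\}$, $w_i=xy$ and $w_{3-i}=yz$ as reduced products with $x,y,z\neq1$; they overlap if they overlap properly or one is a proper subword of the other. A word is non-self-overlapping if it does not overlap itself; $\mathcal N$ is the set of such words. For $1\ne w\in\mathcal N$, $h_w(g)=$ (number of occurrences of $w$ as a subword of $g$) $-$ (number of occurrences of $w^{-1}$). A family $I\subset F$ is independent if no two words in $I$ overlap (so all its words are non-self-overlapping), symmetric if $I=I^{-1}$. $\Sigma_{Ind}$ is the set of functions $\varphi_\alpha=\sum_{w\in\mathcal N^+}\alpha_wh_w$, where $\mathcal N^+\subset\mathcal N$ contains exactly one of $w,w^{-1}$ for each $1\neq w\in\mathcal N$, and $\alpha=\alpha_1+\dots+\alpha_k$ with each $\alpha_i:F\to\mathbb{R}$ bounded, alternating ($(\alpha_i)_{w^{-1}}=-(\alpha_i)_w$), and supported on a symmetric independent family $I_i$. Rolli quasimorphisms: for $\lambda=(\lambda_1,\dots,\lambda_n)$ with $\lambda_i:\mathbb{Z}\to\mathbb{R}$ bounded and alternating, $\phi_\lambda(g)=\sum_j\lambda_{i_j}(m_j)$, where $g=\prod_j s_{i_j}^{m_j}$ is the unique expression with $s_{i_j}\neq s_{i_{j+1}}$, $m_j\in\mathbb{Z}\setminus\{0\}$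 ($\phi_\lambda(1)=0$). *)

(* Defs.v *)
From HB Require Import structures.
From mathcomp Require Import all_boot all_order all_algebra.
From mathcomp Require Import all_classical reals ring lra.
Set Implicit Arguments.
Unset Strict Implicit.
Unset Printing Implicit Defensive.
Import Order.TTheory GRing.Theory Num.Theory.
Local Open Scope ring_scope.

Section BoundedCohomology.
Variables (R : realType) (G : groupType).

(* An element of G^n is a function 'I_n -> G with 0-based indices. *)
Definition cochain (n : nat) := ('I_n -> G) -> R.

HB.instance Definition _ n := GRing.Zmodule.copy (cochain n) (('I_n -> G) -> R).

Definition is_bounded (T : Type) (f : T -> R) :=
  exists M : R, forall x, `|f x| <= M.

Definition merge n (i : nat) (t : 'I_n.+1 -> G) : 'I_n -> G := fun j =>
  if (j < i)%N then t (widen_ord (leqnSn n) j)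
  else if j == i :> nat then (t (widen_ord (leqnSn n) j) * t (lift ord0 j))%g
  else t (lift ord0 j).

(* [merge i t] multiplies the 1-based entries i+1 and i+2, so the i-th summand
   carries the sign (-1)^(i+1). *)
Definition coboundary n (f : cochain n) : cochain n.+1 := fun t =>
  f (fun j => t (lift ord0 j))
  + \sum_(i < n) (-1) ^+ i.+1 * f (merge i t)
  + (-1) ^+ n.+1 * f (fun j => t (widen_ord (leqnSn n) j)).

Definition cup n m (f : cochain n) (f' : cochain m) : cochain (n + m) :=
  fun t => f (fun i => t (lshift m i)) * f' (fun j => t (rshift n j)).

Definition is_bcoboundary n : cochain n -> Prop :=
  if n is n'.+1 then
    fun f => exists2 h : cochain n', is_bounded h & f = coboundary h
  else fun f => f = 0.

Lemma boundedB T (f g : T -> R) : is_bounded f -> is_bounded g ->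
  is_bounded (fun x => f x - g x).
Proof.
move=> [M fM] [N gN]; exists (M + N) => x.
by apply: le_trans (ler_normB _ _) _; rewrite lerD.
Qed.

Lemma boundedM T U V (f : T -> R) (g : U -> R) (a : V -> T) (b : V -> U) :
  is_bounded f -> is_bounded g -> is_bounded (fun x => f (a x) * g (b x)).
Proof.
move=> [M fM] [N gN]; exists (M * N) => x.
by rewrite normrM ler_pM.
Qed.

Lemma bounded0 T : is_bounded (fun _ : T => 0 : R).
Proof. by exists 0 => x; rewrite normr0. Qed.

Lemma coboundary0 n : coboundary (0 : cochain n) = 0.
Proof.
apply/funext => t; rewrite /coboundary !mulr0 add0r addr0.
by rewrite big1 // => i _; rewrite mulr0.
Qed.

Lemma coboundaryB n (f g : cochain n) :
  coboundary (f - g) = coboundary f - coboundary g.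
Proof.
apply/funext => t.
change (coboundary (f - g) t = coboundary f t - coboundary g t).
rewrite /coboundary.
have E u : (f - g) u = f u - g u by [].
rewrite !E (eq_bigr (fun i : 'I_n =>
   (-1) ^+ i.+1 * f (merge i t) - (-1) ^+ i.+1 * g (merge i t))); last first.
  by move=> i _; rewrite E mulrBr.
rewrite sumrB; ring.
Qed.

(* The faces d_0, ..., d_{n+1} of an (n+1)-tuple, in one formula. *)
Definition face n (k : nat) (t : 'I_n.+1 -> G) : 'I_n -> G := fun j =>
  if (j.+1 < k)%N then t (widen_ord (leqnSn n) j)
  else if j.+1 == k then (t (widen_ord (leqnSn n) j) * t (lift ord0 j))%g
  else t (lift ord0 j).

Lemma coboundaryE n (f : cochain n) t :
  coboundary f t = \sum_(k < n.+2) (-1) ^+ k * f (face k t).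
Proof.
rewrite big_ord_recl big_ord_recr /= expr0 mul1r addrA /coboundary.
congr (f _ + _ + _ * f _).
by apply/funext => j; rewrite /face /bump add1n ltnS ltn_ord.
Qed.

Lemma cup_fun n m (f : cochain n) (g : cochain m) t a b :
  (fun i => t (lshift m i)) = a -> (fun j => t (rshift n j)) = b ->
  cup f g t = f a * g b.
Proof. by move=> <- <-. Qed.

Lemma coboundary_cup n m (f : cochain n) (g : cochain m)
    (t : 'I_(n + m).+1 -> G) :
  coboundary (cup f g) t =
    coboundary f (fun i : 'I_n.+1 => t (lshift m i)) *
      g (fun j => t (@rshift n.+1 m j))
    + (-1) ^+ n * (f (fun i => t (widen_ord (leqnSn _) (lshift m i))) *
      coboundary g (fun j => t (cast_ord (addnS n m) (rshift n j)))).
Proof.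
rewrite !coboundaryE.
set t1 := fun i : 'I_n.+1 => _; set t2 := fun j : 'I_m.+1 => t _.
set b := fun j => t _; set a := fun i => t _.
have lo k : (k <= n)%N -> cup f g (face k t) = f (face k t1) * g b.
  move=> kn; apply: cup_fun.
    apply/funext => i; rewrite /face /t1 /=.
    have -> : widen_ord (leqnSn (n + m)) (lshift m i) =
              lshift m (widen_ord (leqnSn n) i) by apply: val_inj.
    by have -> : lift ord0 (lshift m i) = lshift m (lift ord0 i)
      by apply: val_inj.
  apply/funext => j; rewrite /face /b /=.
  have nk : (k <= n + j)%N by apply: leq_trans kn (leq_addr _ _).
  rewrite ltnNge (leqW nk) /= gtn_eqF ?ltnS //.
  by congr (t _); apply: val_inj; rewrite /= /bump add1n addSn.
have hi k : (k <= m)%N -> cup f g (face (n + k.+1) t) = f a * g (face k.+1 t2).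
  move=> km; apply: cup_fun.
    apply/funext => i; rewrite /face /a /=.
    by rewrite addnS ltnS ltn_addr.
  apply/funext => j; rewrite /face /t2 /=.
  rewrite -addnS ltn_add2l eqn_add2l.
  have -> : widen_ord (leqnSn (n + m)) (rshift n j) =
            cast_ord (addnS n m) (rshift n (widen_ord (leqnSn m) j)).
    by apply: val_inj.
  have -> // : lift ord0 (rshift n j) =
            cast_ord (addnS n m) (rshift n (lift ord0 j)).
  by apply: val_inj; rewrite /= /bump !add1n addnS.
have split_sum (F : nat -> R) : \sum_(k < (n + m).+2) F k =
    \sum_(k < n.+1) F k + \sum_(k < m.+1) F (n + k.+1)%N.
  rewrite -addSn -addnS big_split_ord /=; congr (_ + _).
  by apply: eq_bigr => k _; rewrite addSnnS.
have S1 : \sum_(k < n.+1) (-1) ^+ k * cup f g (face k t) =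
    \sum_(k < n.+1) (-1) ^+ k * f (face k t1) * g b.
  by apply: eq_bigr => k _; rewrite lo ?mulrA // -ltnS.
have S2 : \sum_(k < m.+1) (-1) ^+ (n + k.+1) * cup f g (face (n + k.+1) t) =
    (-1) ^+ n * (f a * \sum_(k < m.+1) (-1) ^+ k.+1 * g (face k.+1 t2)).
  rewrite !mulr_sumr; apply: eq_bigr => k _.
  rewrite hi; last by rewrite -ltnS.
  by rewrite exprD -mulrA; congr (_ * _); rewrite mulrCA.
rewrite (split_sum (fun k => (-1) ^+ k * cup f g (face k t))) S1 S2.
have E1 : f (face n.+1 t1) = f a.
  congr f; apply/funext => i; rewrite /face /a /t1 /= ltnS ltn_ord.
  by congr (t _); apply: val_inj.
have E2 : g (face 0 t2) = g b.
  congr g; apply/funext => j; rewrite /face /b /t2 /=.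
  by congr (t _); apply: val_inj; rewrite /= /bump add1n addnS.
rewrite [in RHS]big_ord_recr [X in _ = _ + _ * (_ * X)]big_ord_recl /= E1 E2.
rewrite -mulr_suml exprS expr0.
set A := \sum_(i < n.+1) _; set B := \sum_(i < m.+1) _.
ring.
Qed.

Definition bcocycle_pred n : {pred cochain n} :=
  fun f => `[< is_bounded f /\ coboundary f = 0 >].

Lemma bcocycle_zmod_closed n : zmod_closed (@bcocycle_pred n).
Proof.
split=> [|f g /asboolP[bf cf] /asboolP[bg cg]]; apply/asboolP; split.
- exact: bounded0.
- exact: coboundary0.
- exact: boundedB.
- by rewrite coboundaryB cf cg subr0.
Qed.

HB.instance Definition _ n :=
  GRing.isZmodClosed.Build (cochain n) (@bcocycle_pred n)
    (@bcocycle_zmod_closed n).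

Record bcocycle n := Bcocycle {
  bcocycle_val :> cochain n;
  bcocycleP : bcocycle_val \in @bcocycle_pred n
}.

HB.instance Definition _ n := [isSub for @bcocycle_val n].
HB.instance Definition _ n := [Choice of bcocycle n by <:].
HB.instance Definition _ n := [SubChoice_isSubZmodule of bcocycle n by <:].

Definition bcoboundary_pred n : {pred bcocycle n} :=
  fun z => `[< is_bcoboundary (z : cochain n) >].

Lemma bcoboundary_zmod_closed n : zmod_closed (@bcoboundary_pred n).
Proof.
split=> [|x y /asboolP bx /asboolP yb]; apply/asboolP.
  case: n => [|n] //=; exists 0; first exact: bounded0.
  by rewrite coboundary0.
case: n x y bx yb => [|n] x y /=.
  by move=> x0 y0; rewrite /= x0 y0 subr0.
move=> [h bh xh] [k bk yk]; exists (h - k); first exact: boundedB.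
by rewrite coboundaryB -xh -yk.
Qed.

HB.instance Definition _ n :=
  GRing.isZmodClosed.Build (bcocycle n) (@bcoboundary_pred n)
    (@bcoboundary_zmod_closed n).

Definition Hb n : zmodType := Quotient.quot (@bcoboundary_pred n).

Definition bclass n (z : bcocycle n) : Hb n := \pi_(Hb n)%qT z.

Lemma bounded_cup n m (f : cochain n) (g : cochain m) :
  is_bounded f -> is_bounded g -> is_bounded (cup f g).
Proof. exact: boundedM. Qed.

Lemma bcocycle_bounded n (z : bcocycle n) : is_bounded (z : cochain n).
Proof. by case: z => f /= /asboolP[]. Qed.

Lemma bcocycle_closed n (z : bcocycle n) : coboundary z = 0.
Proof. by case: z => f /= /asboolP[]. Qed.

Lemma bcup_subproof n m (x : bcocycle n) (y : bcocycle m) :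
  cup x y \in @bcocycle_pred (n + m).
Proof.
apply/asboolP; split; first by apply: bounded_cup; exact: bcocycle_bounded.
apply/funext => t; rewrite coboundary_cup !bcocycle_closed.
by rewrite mul0r !mulr0 addr0.
Qed.

Definition bcup n m (x : bcocycle n) (y : bcocycle m) : bcocycle (n + m) :=
  Bcocycle (bcup_subproof x y).

Definition hcup n m (x : Hb n) (y : Hb m) : Hb (n + m) :=
  bclass (bcup (repr x) (repr y)).

Lemma bclass_eq n (x y : bcocycle n) :
  bclass x = bclass y <-> is_bcoboundary (bcocycle_val x - bcocycle_val y).
Proof.
have -> : is_bcoboundary (bcocycle_val x - bcocycle_val y) <->
          x - y \in @bcoboundary_pred n.
  by split=> [|/asboolP]; [move=> h; apply/asboolP|].
by rewrite Quotient.idealrBE; split=> [|/eqP] // e; apply/eqP.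
Qed.

Lemma bclass_eq0 n (x : bcocycle n) :
  bclass x = 0 <-> is_bcoboundary (x : cochain n).
Proof.
have -> : (0 : Hb n) = bclass (0 : bcocycle n) by rewrite /bclass raddf0.
by rewrite bclass_eq subr0.
Qed.

Lemma is_bcoboundary0 n : is_bcoboundary (0 : cochain n).
Proof.
case: n => [|n] //=; exists 0; first exact: bounded0.
by rewrite coboundary0.
Qed.

Lemma is_bcoboundary_cast N N' (e : N'.+1 = N) (f : cochain N) (h : cochain N') :
  is_bounded h ->
  (forall t, f (fun i => t (cast_ord (esym e) i)) = coboundary h t) ->
  is_bcoboundary f.
Proof.
case: N / e f => f bh E; exists h => //; apply/funext => t.
by rewrite -E; congr f; apply/funext => i; rewrite cast_ord_id.
Qed.

Lemma coboundaryZ n c (f : cochain n) t :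
  coboundary (fun u => c * f u) t = c * coboundary f t.
Proof.
by rewrite !coboundaryE mulr_sumr; apply: eq_bigr => k _; rewrite mulrCA.
Qed.

Lemma cup_bcoboundaryl n m (f : cochain n) (y : bcocycle m) :
  is_bcoboundary f -> is_bcoboundary (cup f y).
Proof.
case: n f => [|n] f /=.
  move=> ->; rewrite (_ : cup _ _ = 0); first exact: is_bcoboundary0.
  by apply/funext => t; rewrite /cup mul0r.
move=> [h bh ->]; exists (cup h y).
  by apply: bounded_cup => //; exact: bcocycle_bounded.
apply/funext => t; rewrite coboundary_cup bcocycle_closed.
by rewrite !mulr0 addr0.
Qed.

Lemma cup_bcoboundaryr n m (x : bcocycle n) (g : cochain m) :
  is_bcoboundary g -> is_bcoboundary (cup x g).
Proof.
case: m g => [|m] g /=.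
  move=> ->; rewrite (_ : cup _ _ = 0); first exact: is_bcoboundary0.
  by apply/funext => t; rewrite /cup mulr0.
move=> [h [M hM] ->].
apply: (@is_bcoboundary_cast _ _ (esym (addnS n m)) _
          (fun t => (-1) ^+ n * cup x h t)).
  have [N xN] := bounded_cup (bcocycle_bounded x) (ex_intro _ M hM).
  by exists N => t; rewrite normrM normrX normrN1 expr1n mul1r.
move=> t; rewrite coboundaryZ coboundary_cup bcocycle_closed mul0r add0r.
rewrite mulrA -exprMn mulrNN mul1r expr1n mul1r; congr (bcocycle_val x _ * coboundary h _).
  by apply/funext => i; congr (t _); apply: val_inj.
by apply/funext => i; congr (t _); apply: val_inj.
Qed.

Lemma hcupE n m (x : bcocycle n) (y : bcocycle m) :
  hcup (bclass x) (bclass y) = bclass (bcup x y).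
Proof.
have /bclass_eq xx : bclass (repr (bclass x)) = bclass x by exact: reprK.
have /bclass_eq yy : bclass (repr (bclass y)) = bclass y by exact: reprK.
rewrite /hcup; move: (repr (bclass x) : bcocycle n) xx => x' xx.
move: (repr (bclass y) : bcocycle m) yy => y' yy.
transitivity (bclass (bcup x y')); apply/bclass_eq => /=.
  have := cup_bcoboundaryl y' xx; congr is_bcoboundary.
  by apply/funext => t; exact: mulrBl.
have := cup_bcoboundaryr x yy; congr is_bcoboundary.
by apply/funext => t; exact: mulrBr.
Qed.

(* G -> R as the space of 1-cochains. *)
Definition cochain1 (phi : G -> R) : cochain 1 := fun t => phi (t ord0).

Definition quasimorphism (phi : G -> R) : Prop :=
  is_bounded (coboundary (cochain1 phi)).

Lemma coboundary1E (phi : G -> R) (t : 'I_2 -> G) :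
  coboundary (cochain1 phi) t =
  phi (t ord0) + phi (t (lift ord0 ord0)) - phi (t ord0 * t (lift ord0 ord0))%g.
Proof.
rewrite coboundaryE !big_ord_recl big_ord0 /cochain1 /face /=.
have -> : widen_ord (leqnSn 1) ord0 = ord0 by apply: val_inj.
by rewrite !exprS !expr0; ring.
Qed.

Lemma quasimorphismP (phi : G -> R) :
  quasimorphism phi <->
  exists D, forall g h, `|phi g + phi h - phi (g * h)%g| <= D.
Proof.
split=> -[D hD]; exists D.
  move=> g h; have := hD (fun i => if i == ord0 then g else h).
  by rewrite coboundary1E.
by move=> t; rewrite coboundary1E.
Qed.

Lemma dcocycle_subproof (phi : G -> R) :
  quasimorphism phi -> coboundary (cochain1 phi) \in @bcocycle_pred 2.
Proof.
move=> qphi; apply/asboolP; split=> //; apply/funext => t.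
rewrite coboundaryE !big_ord_recl big_ord0 !coboundary1E /face /=.
set o0 := ord0 : 'I_3; set o1 := lift ord0 ord0 : 'I_3.
set o2 := lift ord0 (lift ord0 ord0) : 'I_3.
have -> : widen_ord (leqnSn 2) ord0 = o0 by apply: val_inj.
have -> : widen_ord (leqnSn 2) (lift ord0 ord0) = o1 by apply: val_inj.
rewrite mulgA !exprS !expr0 -[0 t]/(0 : R); ring.
Qed.

(* The class of delta^1 phi in H^2_b(G). *)
Definition dclass (phi : G -> R) (qphi : quasimorphism phi) : Hb 2 :=
  bclass (Bcocycle (dcocycle_subproof qphi)).

End BoundedCohomology.

Section FreeProduct.
Local Open Scope group_scope.

(* The universal property of the coproduct of groups. *)
Definition is_free_product (A B P : groupType)
    (i1 : {multiplicative A -> P}) (i2 : {multiplicative B -> P}) : Prop :=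
  forall (H : groupType) (f1 : {multiplicative A -> H})
    (f2 : {multiplicative B -> H}),
  exists f : {multiplicative P -> H},
    [/\ forall a, f (i1 a) = f1 a,
        forall b, f (i2 b) = f2 b &
        forall f' : {multiplicative P -> H},
          (forall a, f' (i1 a) = f1 a) -> (forall b, f' (i2 b) = f2 b) ->
          forall x, f' x = f x].

Definition diag_incl (A P : groupType) (i1 i2 : {multiplicative A -> P}) :
  A -> P := fun g => i1 g * i2 g.

Lemma quasimorphism_diag (R : realType) (A P : groupType)
    (i1 i2 : {multiplicative A -> P}) (phi : P -> R) :
  quasimorphism phi -> quasimorphism (phi \o diag_incl i1 i2).
Proof.
move=> /quasimorphismP[D hD]; apply/quasimorphismP; exists (D *+ 5)%R => g h.
rewrite /= /diag_incl !gmulfM.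
have := hD (i1 g) (i2 g); have := hD (i1 h) (i2 h).
have := hD (i1 g) (i1 h); have := hD (i2 g) (i2 h).
have := hD (i1 g * i1 h) (i2 g * i2 h).
rewrite !ler_norml => /andP[a1 a2] /andP[b1 b2] /andP[c1 c2] /andP[d1 d2].
move=> /andP[e1 e2]; apply/andP; split; lra.
Qed.

End FreeProduct.

Section ReducedWords.
Variable n : nat.

(* (i, false) stands for s_i and (i, true) for its inverse. *)
Definition letter : Type := 'I_n * bool.

Definition linv (a : letter) : letter := (a.1, ~~ a.2).

Definition reduced (s : seq letter) := sorted (fun a b => b != linv a) s.

Definition cons_letter (a : letter) (s : seq letter) : seq letter :=
  if s is b :: s' then if b == linv a then s' else a :: s else [:: a].

Definition reduce (s : seq letter) : seq letter := foldr cons_letter [::] s.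

Lemma linvK : involutive linv.
Proof. by case=> i b; rewrite /linv /= negbK. Qed.

Lemma reduced_cons_letter a s : reduced s -> reduced (cons_letter a s).
Proof.
case: s => [|b s] //= bs; case: ifP => [_|ba]; first exact: path_sorted bs.
by rewrite /reduced /= ba bs.
Qed.

Lemma cons_letterK a s :
  reduced s -> cons_letter a (cons_letter (linv a) s) = s.
Proof.
case: s => [|b s] /=; first by rewrite eqxx.
rewrite linvK; case: eqP => [->|_] bs; last by rewrite /= eqxx.
by case: s bs => [|c s] //= /andP[/negPf ->].
Qed.

Lemma reduced_foldr s t : reduced t -> reduced (foldr cons_letter t s).
Proof. by move=> rt; elim: s => //= a s; exact: reduced_cons_letter. Qed.

Lemma reduce_reduced s : reduced (reduce s).
Proof. exact: reduced_foldr. Qed.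

Lemma reduce_id s : reduced s -> reduce s = s.
Proof.
elim: s => //= a s IH pas; rewrite IH; last exact: path_sorted pas.
by case: s pas {IH} => [|b s] //= /andP[/negPf ->].
Qed.

Lemma foldr_reduce s t : reduced t ->
  foldr cons_letter t (reduce s) = foldr cons_letter t s.
Proof.
move=> rt; elim: s => //= a s <-; move: (reduce_reduced s).
case: (reduce s) => [|b s'] //= rs.
case: eqP => //= ->; rewrite cons_letterK //; exact: reduced_foldr.
Qed.

Record freegroup := FreeWord {
  word :> seq letter;
  word_reduced : reduced word
}.

HB.instance Definition _ := [isSub for word].
HB.instance Definition _ := [Choice of freegroup by <:].

Lemma word_inj : injective word. Proof. exact: val_inj. Qed.

Definition fg_one := @FreeWord [::] isT.

Definition fg_mul (u v : freegroup) : freegroup :=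
  FreeWord (reduce_reduced (word u ++ word v)).

Lemma reduced_inv s : reduced s -> reduced (rev (map linv s)).
Proof.
rewrite /reduced rev_sorted sorted_map; apply: sub_sorted => a b /=.
by apply: contraNneq => ->; rewrite linvK.
Qed.

Definition fg_inv (u : freegroup) : freegroup :=
  FreeWord (reduced_inv (word_reduced u)).

Lemma fg_mulE u v : word (fg_mul u v) = foldr cons_letter (word v) (word u).
Proof.
by rewrite /= /reduce foldr_cat -/(reduce _) reduce_id // word_reduced.
Qed.

Lemma fg_mulA : associative fg_mul.
Proof.
move=> u v w; apply: word_inj; rewrite [RHS]fg_mulE.
change (word (fg_mul u v)) with (reduce (word u ++ word v)).
by rewrite foldr_reduce ?word_reduced // foldr_cat !fg_mulE.
Qed.

Lemma fg_mul1g : left_id fg_one fg_mul.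
Proof. by move=> u; apply: word_inj; rewrite fg_mulE. Qed.

Lemma fg_mulg1 : right_id fg_one fg_mul.
Proof.
by move=> u; apply: word_inj; rewrite /= cats0 reduce_id // word_reduced.
Qed.

Lemma fg_invK : involutive fg_inv.
Proof.
move=> u; apply: word_inj; rewrite /= map_rev revK -map_comp.
by rewrite map_id_in // => a _; exact: linvK.
Qed.

Lemma fg_mulVg : left_inverse fg_one fg_inv fg_mul.
Proof.
move=> u; apply: word_inj; rewrite fg_mulE /=.
elim: (word u) => //= a s IH; rewrite rev_cons -cats1 foldr_cat /=.
by rewrite linvK eqxx.
Qed.

Lemma fg_mulgV : right_inverse fg_one fg_inv fg_mul.
Proof. by move=> u; rewrite -{1}(fg_invK u) fg_mulVg. Qed.

HB.instance Definition _ := isGroup.Build freegroup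
  fg_mulA fg_mul1g fg_mulg1 fg_mulVg fg_mulgV.

End ReducedWords.

Section Words.
Variables (R : realType) (n : nat).
Local Notation F := (freegroup n).
Implicit Types (u v w g : F) (I : set F).

Definition fg_gen (i : 'I_n) : F := @FreeWord n [:: (i, false)] isT.

(* A product of reduced words is reduced (no cancellation) exactly when its word
   is the concatenation of theirs, hence the use of [++] and [infix] below. *)
Definition subword w g := infix (word w) (word g).

Definition proper_subword w g := subword w g /\ w <> g.

Definition overlap_properly w1 w2 : Prop :=
  exists x y z : F,
    [/\ x <> 1%g, y <> 1%g, z <> 1%g &
      (word w1 = word x ++ word y /\ word w2 = word y ++ word z) \/
      (word w2 = word x ++ word y /\ word w1 = word y ++ word z)].

Definition overlap w1 w2 : Prop :=
  [\/ overlap_properly w1 w2, proper_subword w1 w2 | proper_subword w2 w1].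

Definition non_self_overlapping : set F := [set w | ~ overlap w w]%classic.

Definition occurrences w g : nat :=
  count (fun k => prefix (word w) (drop k (word g))) (iota 0 (size (word g))).

Definition h_count w g : R := (occurrences w g)%:R - (occurrences w^-1%g g)%:R.

Definition independent_family I : Prop :=
  forall w1 w2, I w1 -> I w2 -> ~ overlap w1 w2.

Definition symmetric_family I : Prop := forall w, I w <-> I w^-1%g.

Definition is_Nplus (Np : set F) : Prop :=
  (forall w, Np w -> non_self_overlapping w /\ w <> 1%g) /\
  (forall w, non_self_overlapping w -> w <> 1%g ->
     (Np w \/ Np w^-1%g) /\ ~ (Np w /\ Np w^-1%g)).

(* For each g the sum has finite support: only subwords of g and inverses of
   subwords of g contribute. *)
Definition phi_alpha (Np : set F) (alpha : F -> R) : F -> R :=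
  fun g => \sum_(w \in Np) alpha w * h_count w g.

Definition Sigma_Ind (Np : set F) (phi : F -> R) : Prop :=
  exists (k : nat) (a : 'I_k -> F -> R) (I : 'I_k -> set F),
    (forall i,
      [/\ is_bounded (a i),
          forall w, a i w^-1%g = - a i w,
          forall w, a i w <> 0 -> I i w,
          symmetric_family (I i) &
          independent_family (I i)]) /\
    phi = phi_alpha Np (fun w => \sum_i a i w).

Definition expgz (G : groupType) (x : G) (m : int) : G :=
  match m with Posz p => (x ^+ p)%g | Negz p => (x ^- p.+1)%g end.

Definition syllable_form (e : seq ('I_n * int)) : bool :=
  all (fun p => p.2 != 0) e && sorted (fun p q => p.1 != q.1) e.

Definition syllable_prod (e : seq ('I_n * int)) : F :=
  (\prod_(p <- e) expgz (fg_gen p.1) p.2)%g.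

Definition is_phi_lambda (lam : 'I_n -> int -> R) (phi : F -> R) : Prop :=
  forall g e, syllable_form e -> g = syllable_prod e ->
    phi g = \sum_(p <- e) lam p.1 p.2.

Definition Rolli (phi : F -> R) : Prop :=
  exists lam : 'I_n -> int -> R,
    (forall i, is_bounded (lam i) /\ forall m, lam i (- m) = - lam i m) /\
    is_phi_lambda lam phi.

End Words.

(* Main.v *)
(* The cup product of [delta phi] with any bounded 2-cocycle [w] has an explicit
   bounded primitive.  Refine [phi g] to a finitely supported signed measure [T g]
   on the group, of total mass [phi g], such that [T (g h) - (T g) h - T h] is
   bounded in total variation.  Evaluating this defect of [(g, h)] on the function
   [w(., k)] gives, up to sign, a bounded 3-cochain, and the cocycle equation of
   [w] shows that its coboundary is the cup product of [delta phi] and [w].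

   On the free group, [phi g] is a sum of alternating weights of pieces of [g]
   (occurrences of words of an independent family, or syllables).  The measure
   [T g] puts half of the weight of a piece on the suffix of [g] starting with the
   piece and half on the suffix starting after it.  This symmetric choice makes
   [T] exactly compatible with inversion, so the cancelled part of a product [g h]
   contributes nothing, and only boundedly many pieces at the junction are left. *)
Require Import Defs.
From mathcomp Require Import all_boot all_order all_algebra.
From mathcomp Require Import all_classical reals ring lra zify.
Set Implicit Arguments.
Unset Strict Implicit.
Unset Printing Implicit Defensive.
Import Order.TTheory GRing.Theory Num.Theory.
Local Open Scope ring_scope.

(** * Quasimorphisms refined to measures, and bounded primitives of cup products *)

Section Liftable.
Variables (R : realType) (G : groupType).
Implicit Types (phi : G -> R) (g h : G) (f : G -> R).

(* [T g f] is the integral of [f] against the measure attached to [g]. *)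
Definition liftable phi : Prop :=
  exists T : G -> (G -> R) -> R,
  [/\ forall g c f1 f2, T g (fun x => c * f1 x + f2 x) = c * T g f1 + T g f2,
      forall g, T g (fun=> 1) = phi g &
      exists C, forall g h f M, (forall x, `|f x| <= M) ->
        `|T (g * h)%g f - T g (fun x => f (x * h)%g) - T h f| <= C * M].

(** Testing the defect of [T] on the constant function 1 gives, up to sign, the defect of [phi]. *)
Lemma liftable_quasimorphism phi : liftable phi -> quasimorphism phi.
Proof.
move=> [T [_ T1 [C TC]]]; apply/quasimorphismP; exists C => g h.
have := TC g h (fun=> 1) 1; rewrite normr1 lexx mulr1 !T1 => /(_ (fun=> isT)).
by rewrite -normrN; congr (`|_| <= _); ring.
Qed.

(** The cocycle equation at [x, y, v], solved for the term whose first argument is a product: this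
    is the term that right translation produces under the measure. *)
Lemma bcocycle2E (z : bcocycle R G 2) (w : G -> G -> R) :
  (forall t, bcocycle_val z t = w (t ord0) (t (lift ord0 ord0))) ->
  forall x y v, w (x * y)%g v = w y v + w x (y * v)%g - w x y.
Proof.
move=> zw x y v.
pose t : 'I_3 -> G := fun i => nth 1%g [:: x; y; v] i.
have : coboundary z t = 0 by rewrite bcocycle_closed.
rewrite coboundaryE !big_ord_recl big_ord0 !zw /face /=.
by rewrite /t /= !exprS !expr0 => ?; lra.
Qed.

Lemma cup_liftable phi (z : bcocycle R G 2) : liftable phi ->
  is_bcoboundary (cup (coboundary (cochain1 phi)) z).
Proof.
move=> [T [TL T1 [C TC]]].
pose w x y := bcocycle_val z (fun i : 'I_2 => if i == ord0 then x else y).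
have zw t : bcocycle_val z t = w (t ord0) (t (lift ord0 ord0)).
  congr (bcocycle_val z _); apply/funext => i.
  by case: (unliftP ord0 i) => [j ->|-> //]; rewrite (ord1 j).
have wE := bcocycle2E zw.
have [M zM] := bcocycle_bounded z.
have wM x y : `|w x y| <= M by exact: zM.
(* The cocycle equation is integrated over its first entry; the summand [w k l] does not depend on
   [x] and picks up the total mass [phi g]. *)
have w_shift g h k l : T g (fun x => w (x * (h * k))%g l) =
    phi g * w k l + T g (fun x => w (x * h)%g (k * l)%g)
    - T g (fun x => w (x * h)%g k).
  have -> : (fun x => w (x * (h * k))%g l) = (fun x => w k l * 1 +
     (-1 * w (x * h)%g k + w (x * h)%g (k * l)%g)).
    by apply/funext => x; rewrite mulgA [w (x * h * k)%g l]wE; ring.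
  by rewrite !TL T1; ring.
have w_shift1 g k l : T g (fun x => w (x * k)%g l) =
    phi g * w k l + T g (w^~ (k * l)%g) - T g (w^~ k).
  have w1 m : (fun x => w (x * 1)%g m) = w^~ m.
    by apply/funext => x; rewrite mulg1.
  by have := w_shift g 1%g k l; rewrite mul1g !w1.
(* Minus the defect of [T] at the pair [g, h], tested on [w^~ k]; hence bounded by [C * M]. *)
pose b g h k :=
  T g (fun x => w (x * h)%g k) + T h (w^~ k) - T (g * h)%g (w^~ k).
exists (fun t : 'I_3 -> G =>
  b (t ord0) (t (lift ord0 ord0)) (t (lift ord0 (lift ord0 ord0)))).
  exists (C * M) => t; rewrite -normrN /b.
  set g := t _; set h := t _; set k := t _.
  have := TC g h (w^~ k) M (fun x => wM x k).
  by congr (`|_| <= _); ring.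
apply/funext => t.
pose s j : G := t (inord j).
have ts i : t i = s i by rewrite /s inord_val.
rewrite [RHS]coboundaryE !big_ord_recl big_ord0 /cup coboundary1E zw /face /=.
rewrite !ts /= /bump !add1n !addn0 /= !exprS expr0 /b.
move: (s 0) (s 1) (s 2) (s 3) => g h k l.
(* The shifted integrals come from the faces [b g (hk) l], [b h k l] and [b (gh) k l]. Their masses
   add up to the defect of [phi] at [g, h] times [w k l]; all other terms cancel. *)
rewrite (w_shift g h k l) (w_shift1 h k l) (w_shift1 (g * h)%g k l).
rewrite !mulgA; ring.
Qed.

Lemma liftable_sum k (phi : 'I_k -> G -> R) :
  (forall i, liftable (phi i)) -> liftable (fun g => \sum_i phi i g).
Proof.
move=> /choice[T /all_and3 [TL T1 TC]].
have /choice[C CT] := TC.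
exists (fun g f => \sum_i T i g f); split=> [g c f1 f2|g|].
- by rewrite mulr_sumr -big_split; apply: eq_bigr => i _; exact: TL.
- by apply: eq_bigr => i _; exact: T1.
exists (\sum_i C i) => g h f M fM; rewrite -!sumrB mulr_suml.
by apply: le_trans (ler_norm_sum _ _ _) (ler_sum _ _) => i _; exact: CT.
Qed.

End Liftable.

(** * Reduced words as group elements, and cancellation in a product *)

Section FreeWords.
Variable n : nat.
Implicit Types (s t : seq (letter n)) (g h : freegroup n).

(* Reducing first makes [fgw] a monoid morphism defined on all sequences. *)
Definition fgw s : freegroup n := FreeWord (reduce_reduced s).

Definition winv s := rev (map (@linv n) s).

Lemma fgwK g : fgw (word g) = g.
Proof. by apply: word_inj; rewrite /= reduce_id // word_reduced. Qed.

Lemma word_fgw s : reduced s -> word (fgw s) = s.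
Proof. exact: reduce_id. Qed.

Lemma fgw_cat s t : fgw (s ++ t) = (fgw s * fgw t)%g.
Proof.
apply: word_inj; rewrite [RHS]fg_mulE /= foldr_reduce ?reduce_reduced //.
by rewrite /reduce foldr_cat.
Qed.

Lemma fgw_nil : fgw [::] = 1%g.
Proof. exact: word_inj. Qed.

Lemma winv_cat s t : winv (s ++ t) = winv t ++ winv s.
Proof. by rewrite /winv map_cat rev_cat. Qed.

Lemma size_winv s : size (winv s) = size s.
Proof. by rewrite size_rev size_map. Qed.

Lemma word_inv g : word g^-1%g = winv (word g).
Proof. by []. Qed.

Lemma fgw_inv s : fgw (winv s) = (fgw s)^-1%g.
Proof.
elim: s => [|x s IH]; first by rewrite fgw_nil invg1.
rewrite -cat1s winv_cat !fgw_cat IH invgM; congr (_ * _)%g.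
by apply: word_inj.
Qed.

Lemma reduced_infix s t : infix s t -> reduced t -> reduced s.
Proof. exact: infix_sorted. Qed.

Lemma reduced_cat_rcons s t x y : reduced (rcons s x) -> reduced (y :: t) ->
  y != linv x -> reduced (rcons s x ++ y :: t).
Proof.
rewrite /reduced; case: s => [|z s] /=; first by move=> _ -> ->.
by rewrite cat_path last_rcons /= => -> -> ->.
Qed.

(** Letters at the junction are peeled off as long as they are mutually inverse; [c] collects the
    part of [s] lost in this way. *)
Lemma word_cancel s t : reduced s -> reduced t ->
  exists a c b, [/\ s = a ++ c, t = winv c ++ b & reduced (a ++ b)].
Proof.
elim/last_ind: s t => [|s x IH] t rs rt; first by exists [::], [::], t.
case: t rt => [|y t] rt.
  by exists (rcons s x), [::], [::]; rewrite !cats0.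
have [yx|yx] := eqVneq y (linv x); last first.
  exists (rcons s x), [::], (y :: t); split; rewrite ?cats0 //.
  exact: reduced_cat_rcons.
have [||a [c [b [-> -> rab]]]] := IH t.
- by apply: reduced_infix rs; rewrite -cats1 prefix_infix.
- exact: path_sorted rt.
exists a, (rcons c x), b; split=> //; first by rewrite rcons_cat.
by rewrite yx -cats1 winv_cat.
Qed.

End FreeWords.

(** * Reduction of the defect bound to products without cancellation *)

Section WordLifts.
Variables (R : realType) (n : nat).
Local Notation F := (freegroup n).

(** Write [g = u v] and [h = v^-1 w] with [u w] reduced. The pairs [u, w], then [u, v], then
    [v^-1, w] have no cancellation, and by compatibility with inversion the terms of [v] and [v^-1]
    cancel exactly. Three defects remain, whence [C *+ 3]. *)
Lemma liftable_words (T : F -> (F -> R) -> R) C :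
  (forall g c f1 f2, T g (fun x => c * f1 x + f2 x) = c * T g f1 + T g f2) ->
  (forall g f, T g^-1%g f = - T g (fun x => f (x * g^-1)%g)) ->
  (forall g h f M, reduced (word g ++ word h) -> (forall x, `|f x| <= M) ->
    `|T (g * h)%g f - T g (fun x => f (x * h)%g) - T h f| <= C * M) ->
  liftable (fun g => T g (fun=> 1)).
Proof.
move=> TL TV TC; exists T; split=> //; exists (C *+ 3) => g h f M fM.
have [u [v [w [gE hE ruw]]]] := word_cancel (word_reduced g) (word_reduced h).
have rg := word_reduced g; have rh := word_reduced h; rewrite gE hE in rg rh.
have [ru rv] : reduced u /\ reduced v.
  by split; apply: reduced_infix rg; [exact: prefix_infix|exact: suffix_infix].
have [rv' rw] : reduced (winv v) /\ reduced w.
  by split; apply: reduced_infix rh; [exact: prefix_infix|exact: suffix_infix].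
have {}gE : g = (fgw u * fgw v)%g by rewrite -fgw_cat -gE fgwK.
have {}hE : h = ((fgw v)^-1 * fgw w)%g by rewrite -fgw_inv -fgw_cat -hE fgwK.
have ghE : (g * h = fgw u * fgw w)%g by rewrite gE hE mulgA mulgK.
have Euw := TC (fgw u) (fgw w) f M.
have Euv := TC (fgw u) (fgw v) (fun x => f (x * h)%g) M.
have Evw := TC (fgw v)^-1%g (fgw w) f M.
move: Euw Euv Evw; rewrite word_inv !word_fgw // => /(_ ruw fM) Euw.
move=> /(_ rg (fun=> fM _)) Euv /(_ rh fM) Evw.
rewrite ghE; rewrite -gE in Euv; rewrite -hE TV in Evw.
have E1 : (fun x => f (x * fgw v * h)%g) = (fun x => f (x * fgw w)%g).
  by apply/funext => x; rewrite hE !mulgA mulgK.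
have E2 : (fun x => f (x * (fgw v)^-1 * fgw w)%g) = (fun x => f (x * h)%g).
  by apply/funext => x; rewrite hE mulgA.
rewrite E1 in Euv; rewrite E2 in Evw.
move: Euw Euv Evw; rewrite !ler_norml => /andP[? ?] /andP[? ?] /andP[? ?].
by apply/andP; split; lra.
Qed.

End WordLifts.

Lemma norm_sum_unique (R : realType) (I : finType) (F : I -> R) B : 0 <= B ->
  (forall i, `|F i| <= B) -> (forall i j, F i != 0 -> F j != 0 -> i = j) ->
  `|\sum_i F i| <= B.
Proof.
move=> B0 FB F1; case: (pickP (fun i => F i != 0)) => [i Fi|F0].
  rewrite (bigD1 i) //= big1 ?addr0 // => j ji.
  by apply/eqP; apply: contra_neqT ji => /F1; exact.
by rewrite big1 ?normr0 // => i _; apply/eqP; rewrite -[_ == _]negbK F0.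
Qed.

(** * Measures for counting sums with weights on an independent family *)

Section Independent.
Variables (R : realType) (n : nat).
Local Notation F := (freegroup n).
Variables (a : F -> R) (I : set F) (B : R).
Hypotheses (aB : forall w, `|a w| <= B) (aV : forall w, a w^-1%g = - a w).
Hypotheses (aI : forall w, a w <> 0 -> I w) (indI : independent_family I).
Implicit Types (s t : seq (letter n)) (f : F -> R).

Definition slice k l s : F := fgw (drop k (take l s)).

(** The indices are cut points between letters, ranging from 0 to [size s], so that inversion acts
    on them by [i] to [size s - i]. Summing over all pairs of cuts replaces summing over words, as
    the weight [a] selects the relevant pieces. *)
Definition ind_term s f k l : R :=
  if (k < l)%N then
    a (slice k l s) * ((f (fgw (drop k s)) + f (fgw (drop l s))) / 2)
  else 0.

Definition ind_lift s f : R :=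
  \sum_(k < (size s).+1) \sum_(l < (size s).+1) ind_term s f k l.

Lemma ind_lift_linear s c f1 f2 :
  ind_lift s (fun x => c * f1 x + f2 x) = c * ind_lift s f1 + ind_lift s f2.
Proof.
rewrite /ind_lift mulr_sumr -big_split; apply: eq_bigr => k _ /=.
rewrite mulr_sumr -big_split; apply: eq_bigr => l _ /=.
by rewrite /ind_term; case: ifP => _; field.
Qed.

(** The suffix of the inverse word at cut [size s - i] is the suffix of [s] at cut [i] times the
    inverse of [s]. Inversion therefore swaps the two points carrying half the weight each, and the
    weight changes sign by [aV]. *)
Lemma ind_term_inv s f k l : (k <= size s)%N -> (l <= size s)%N ->
  ind_term (winv s) f (size s - l) (size s - k) =
  - ind_term s (fun x => f (x * (fgw s)^-1)%g) k l.
Proof.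
move=> ks ls; rewrite /ind_term.
have -> : (size s - l < size s - k)%N = (k < l)%N by lia.
have fE i : (i <= size s)%N ->
    fgw (drop (size s - i) (winv s)) = (fgw (drop i s) * (fgw s)^-1)%g.
  move=> iN; rewrite -size_drop -{2 4}(cat_take_drop i s) winv_cat.
  rewrite drop_size_cat.
    by rewrite fgw_inv fgw_cat invgM mulgA mulgV mul1g.
  exact: size_winv.
case: ifP => [kl|_]; last by rewrite oppr0.
rewrite !fE // [X in _ * (X / 2)]addrC -mulNr -aV; congr (a _ * _).
rewrite /slice -fgw_inv; congr fgw.
rewrite -!size_drop -{3}(cat_take_drop k s) winv_cat -(size_winv (drop k s)).
rewrite take_size_cat //.
have -> : winv (drop k s) = winv (drop l s) ++ winv (drop k (take l s)).
  by rewrite -winv_cat -{1}(cat_take_drop l s) drop_cat size_takel // kl.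
by rewrite drop_size_cat // size_winv.
Qed.

Lemma ind_lift_inv s f :
  ind_lift (winv s) f = - ind_lift s (fun x => f (x * (fgw s)^-1)%g).
Proof.
rewrite /ind_lift size_winv exchange_big (reindex_inj rev_ord_inj) /= -sumrN.
apply: eq_bigr => k _; rewrite (reindex_inj rev_ord_inj) /= -sumrN.
by apply: eq_bigr => l _; rewrite !subSS ind_term_inv // -ltnS.
Qed.

Lemma slice_word s k l : reduced s -> word (slice k l s) = drop k (take l s).
Proof. by move=> rs; rewrite word_fgw //; apply/drop_sorted/take_sorted. Qed.

Lemma slice_cat s k l m : (k <= l <= m)%N -> (m <= size s)%N ->
  drop k (take m s) = drop k (take l s) ++ drop l (take m s).
Proof.
move=> /andP[kl lm] ms; have ls := leq_trans lm ms.
rewrite -{1}(cat_take_drop l (take m s)) take_takel // drop_cat size_takel //.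
move: kl; rewrite leq_eqVlt => /predU1P[->|->] //.
by rewrite ltnn subnn drop0 [X in _ = X ++ _]drop_oversize // size_takel.
Qed.

Lemma overlapC (v w : F) : overlap v w -> overlap w v.
Proof.
case=> [[x [y [z [x1 y1 z1 H]]]]|H|H]; [|exact: Or33|exact: Or32].
by apply: Or31; exists x, y, z; split=> //; case: H; [right|left].
Qed.

(** Distinct intervals of positions that meet are either nested, giving a proper subword, or
    crossing; in the latter case the four cuts delimit the nonempty factors of a proper overlap. *)
Lemma overlap_slices s k l k' l' : reduced s ->
  (k < l <= size s)%N -> (k' < l' <= size s)%N -> (k' < l)%N -> (k < l')%N ->
  (k, l) <> (k', l') -> overlap (slice k l s) (slice k' l' s).
Proof.
move=> rs.
(* By symmetry the first interval starts strictly earlier, or both start together and the second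
   ends strictly earlier. *)
wlog kk' : k l k' l' / (k < k')%N || (k == k') && (l' < l)%N.
  move=> W kl kl' k'l kl'' ne; have := W k l k' l'.
  have := W k' l' k l; have : (k != k') || (l != l').
    by rewrite -negb_and -xpair_eqE; apply/eqP.
  case: (ltngtP k k') => [kk'|kk'|kk'] /= _.
  - by move=> _; apply.
  - move=> /(_ isT) W' _; apply/overlapC/W' => // -[e1 e2].
    by apply: ne; rewrite e1 e2.
  case: (ltngtP l l') => [ll'|ll'|ll'] /=.
  - move=> /(_ isT) W' _; apply/overlapC/W' => // -[e1 e2].
    by apply: ne; rewrite e1 e2.
  - by move=> _; apply.
  - by case: ne; rewrite kk' ll'.
move=> /andP[kl ls] /andP[kl' ls'] k'l kl'' ne.
have size_slice i j : (j <= size s)%N -> size (word (slice i j s)) = (j - i)%N.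
  by move=> js; rewrite slice_word // size_drop size_takel.
have [l'l|ll'] := leqP l' l.
  apply: Or33; split; last first.
    move=> /(congr1 (fun g => size (word g))); rewrite !size_slice //.
    case/orP: kk' => [|/andP[]]; lia.
  rewrite /subword !slice_word // (@slice_cat _ k k'); last 2 first.
  - by lia.
  - by [].
  by rewrite (@slice_cat _ k' l' l) ?infix_infix //; lia.
have {}kk' : (k < k')%N by case/orP: kk' => [|/andP[_]] //; lia.
have slice1 i j : (i < j <= size s)%N -> slice i j s <> 1%g.
  move=> /andP[ij js] /(congr1 (fun g => size (word g))).
  by rewrite size_slice //= => /eqP; rewrite subn_eq0 leqNgt ij.
apply: Or31; exists (slice k k' s), (slice k' l s), (slice l l' s).
split; try (by apply: slice1; lia).
by left; split; rewrite !slice_word // -slice_cat //; lia.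
Qed.

Lemma ind_term_catl s t f k l : (k < size s)%N -> (l <= size s)%N ->
  ind_term (s ++ t) f k l = ind_term s (fun x => f (x * fgw t)%g) k l.
Proof.
move=> ks ls; rewrite /ind_term; case: ifP => // kl.
have dropE i : (i <= size s)%N -> drop i (s ++ t) = drop i s ++ t.
  rewrite drop_cat leq_eqVlt => /predU1P[->|-> //].
  by rewrite ltnn subnn drop0 drop_size.
by rewrite /slice takel_cat // !dropE ?fgw_cat // ltnW.
Qed.

Lemma ind_term_catr s t f k l :
  ind_term (s ++ t) f (size s + k) (size s + l) = ind_term t f k l.
Proof.
rewrite /ind_term ltn_add2l; case: ifP => // kl.
have dropE i r : drop (size s + i) (s ++ r) = drop i r.
  by rewrite drop_cat ltnNge leq_addr /= addKn.
have takeE : take (size s + l) (s ++ t) = s ++ take l t.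
  by rewrite take_cat ltnNge leq_addr /= addKn.
by rewrite /slice takeE !dropE.
Qed.

(** Pieces inside [s] or inside [t] are accounted for by the subtracted terms. Any two distinct
    pieces straddling the junction overlap, so independence leaves at most one term, of size at most
    [B * M]. *)
Lemma ind_lift_cat s t f M : reduced (s ++ t) -> (forall x, `|f x| <= M) ->
  `|ind_lift (s ++ t) f - ind_lift s (fun x => f (x * fgw t)%g) - ind_lift t f|
    <= B * M.
Proof.
move=> rst fM.
have B0 : 0 <= B by apply: le_trans (aB 1%g).
have M0 : 0 <= M by apply: le_trans (fM 1%g).
set p := size s; set q := size t; set u := s ++ t.
(* A straddling piece starts at a cut [k < p] and ends strictly beyond [p], at a cut written
   [p + l.+1]. *)
have -> : ind_lift u f - ind_lift s (fun x => f (x * fgw t)%g) - ind_lift t f =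
    \sum_(kl : 'I_p * 'I_q) ind_term u f kl.1 (p + kl.2.+1).
  have sum_split (H : nat -> R) i j :
      \sum_(k < i + j) H k = \sum_(k < i) H k + \sum_(k < j) H (i + k)%N.
    by rewrite big_split_ord.
  rewrite /ind_lift size_cat -/p -/q -addnS.
  rewrite (sum_split (fun k => \sum_(l < p + q.+1) ind_term u f k l)).
  have -> : \sum_(k < q.+1) \sum_(l < p + q.+1) ind_term u f (p + k) l =
      \sum_(k < q.+1) \sum_(l < q.+1) ind_term t f k l.
    apply: eq_bigr => k _; rewrite (sum_split (ind_term u f (p + k))).
    rewrite big1 ?add0r => [|l _].
      by apply: eq_bigr => l _; rewrite ind_term_catr.
    by rewrite /ind_term ltnNge (leq_trans (ltnW (ltn_ord l))) ?leq_addr.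
  rewrite [X in _ - X - _]big_ord_recr /=.
  rewrite [X in _ - (_ + X) - _]big1 => [|l _]; last first.
    by rewrite /ind_term ltnNge -ltnS ltn_ord.
  rewrite addr0 addrAC addrK -sumrB.
  rewrite -(pair_bigA _
    (fun (k : 'I_p) (l : 'I_q) => ind_term u f k (p + l.+1))).
  apply: eq_bigr => k _; rewrite addnS -addSn (sum_split (ind_term u f k)).
  rewrite addrAC [X in _ - X](eq_bigr (fun l : 'I_p.+1 => ind_term u f k l)).
    by rewrite subrr add0r; apply: eq_bigr => l _; rewrite addSnnS.
  by move=> l _; rewrite ind_term_catl // -ltnS.
apply: norm_sum_unique => [|[k l]|[k l] [k' l']] /=; first exact: mulr_ge0.
  rewrite /ind_term; case: ifP => _; last by rewrite normr0 mulr_ge0.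
  rewrite normrM ler_pM // ler_norml.
  have := fM (fgw (drop k u)); have := fM (fgw (drop (p + l.+1) u)).
  by rewrite !ler_norml => /andP[? ?] /andP[? ?]; apply/andP; split; lra.
rewrite /ind_term; case: ifP => [kl|_]; last by rewrite eqxx.
case: ifP => [kl'|_]; last by rewrite eqxx.
rewrite !mulf_eq0 !negb_or => /andP[/eqP/aI Iw _] /andP[/eqP/aI Iw' _].
apply: contrapT => ne; apply: (indI Iw Iw'); apply: overlap_slices => //.
- by rewrite kl size_cat leq_add2l ltn_ord.
- by rewrite kl' size_cat leq_add2l ltn_ord.
- by apply: leq_trans (ltn_ord k') _; rewrite leq_addr.
- by apply: leq_trans (ltn_ord k) _; rewrite leq_addr.
- by move=> [] /val_inj kk' /addnI [/val_inj ll']; case: ne; rewrite kk' ll'.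
Qed.

Lemma liftable_ind : liftable (fun g => ind_lift (word g) (fun=> 1)).
Proof.
apply: (@liftable_words _ _ (fun g => ind_lift (word g)) B).
- by move=> *; exact: ind_lift_linear.
- by move=> g f; rewrite word_inv ind_lift_inv fgwK.
move=> g h f M rgh fM.
have -> : word (g * h)%g = word g ++ word h by rewrite /= reduce_id.
by have := ind_lift_cat rgh fM; rewrite fgwK.
Qed.

End Independent.

(** * Syllable forms and measures for Rolli quasimorphisms *)

Section Rolli.
Variables (R : realType) (n : nat).
Local Notation F := (freegroup n).
Local Notation syllables := (seq ('I_n * int)).
Implicit Types (e : syllables) (f : F -> R).

Definition syl (p : 'I_n * int) : F := expgz (fg_gen p.1) p.2.

(** Presenting exponents as differences of naturals spares [expgzD] a case analysis on signs. *)
Lemma expgz_subn (G : groupType) (x : G) (a b : nat) :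
  expgz x (a%:Z - b%:Z) = (x ^+ a * x ^- b)%g.
Proof.
have [ba|ab] := leqP b a.
  by rewrite subzn // -{2}(subnK ba) expgnDr mulgK.
have -> : a%:Z - b%:Z = Negz (b - a).-1 by lia.
rewrite /= prednK ?subn_gt0 // -{2}(subnK (ltnW ab)).
by rewrite expgnDr invgM mulgA mulgV mul1g.
Qed.

Lemma expgzD (G : groupType) (x : G) (m k : int) :
  expgz x (m + k) = (expgz x m * expgz x k)%g.
Proof.
have intE (j : int) : exists a b : nat, j = a%:Z - b%:Z.
  by case: j => a; [exists a, 0|exists 0, a.+1]; lia.
have [a [b ->]] := intE m; have [c [d ->]] := intE k.
have -> : a%:Z - b%:Z + (c%:Z - d%:Z) = (a + c)%N%:Z - (d + b)%N%:Z by lia.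
rewrite !expgz_subn !expgnDr invgM -!mulgA; congr (_ * _)%g; rewrite !mulgA.
congr (_ * _)%g; apply/commuteV/commuteX2; exact: commute_refl.
Qed.

Definition syl_letters (p : 'I_n * int) : seq (letter n) :=
  nseq `|p.2|%N (p.1, p.2 < 0).

Lemma syllable_prod_cons p e :
  syllable_prod (p :: e) = (syl p * syllable_prod e)%g.
Proof. by rewrite /syllable_prod big_cons. Qed.

Lemma syllable_prod_cat e1 e2 :
  syllable_prod (e1 ++ e2) = (syllable_prod e1 * syllable_prod e2)%g.
Proof. by rewrite /syllable_prod big_cat. Qed.

Lemma syllable_form_cat2 e1 e2 :
  syllable_form (e1 ++ e2) -> syllable_form e1 /\ syllable_form e2.
Proof.
by rewrite /syllable_form all_cat => /andP[/andP[-> ->]] /cat_sorted2[-> ->].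
Qed.

Lemma sylE p : syl p = fgw (syl_letters p).
Proof.
have genX i a : (fg_gen i ^+ a)%g = fgw (nseq a (i, false)).
  elim: a => [|a IH]; first by rewrite fgw_nil.
  rewrite expgS IH -[nseq a.+1 _]/([:: _] ++ nseq a _) fgw_cat.
  by congr (_ * _)%g; apply: word_inj.
case: p => i [a|a]; rewrite /syl /syl_letters /= genX // -fgw_inv.
by rewrite /winv map_nseq rev_nseq.
Qed.

Lemma syllable_prodE e : syllable_prod e = fgw (flatten (map syl_letters e)).
Proof.
elim: e => [|p e IH]; first by rewrite fgw_nil /syllable_prod big_nil.
by rewrite syllable_prod_cons IH sylE -fgw_cat.
Qed.

Lemma syl_lettersE p : p.2 != 0 ->
  syl_letters p = (p.1, p.2 < 0) :: nseq `|p.2|%N.-1 (p.1, p.2 < 0).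
Proof. by rewrite /syl_letters -absz_eq0; case: `|_|%N. Qed.

Lemma reduced_nseq a (x : letter n) : reduced (nseq a x).
Proof.
case: a => //= a; elim: a => //= a IH; rewrite /reduced /= IH andbT.
by case: x {IH} => i []; rewrite xpair_eqE andbF.
Qed.

Lemma reduced_syllables e :
  syllable_form e -> reduced (flatten (map syl_letters e)).
Proof.
elim: e => //= p [|q e] IH; rewrite /syllable_form.
  by rewrite /= cats0 => _; exact: reduced_nseq.
move=> /andP[/= /andP[p0 qe0] /andP[pq qe]].
have {IH} : reduced (flatten (map syl_letters (q :: e))).
  by apply: IH; apply/andP.
have q0 : q.2 != 0 by case/andP: qe0.
rewrite /= syl_lettersE //= => rq.
have -> : syl_letters p =
    rcons (nseq `|p.2|%N.-1 (p.1, p.2 < 0)) (p.1, p.2 < 0).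
  by rewrite syl_lettersE // -cats1 -[[:: _]]/(nseq 1 _) -nseqD addn1.
apply: reduced_cat_rcons => //; last first.
  by rewrite xpair_eqE negb_and eq_sym pq.
by rewrite -cats1 -[[:: _]]/(nseq 1 _) -nseqD; exact: reduced_nseq.
Qed.

(** The first syllable can be read off the word: its first letter gives generator and sign, and the
    length of the initial run of that generator, located by [find], gives the absolute value of the
    exponent. *)
Lemma flatten_syllables_inj e1 e2 : syllable_form e1 -> syllable_form e2 ->
  flatten (map syl_letters e1) = flatten (map syl_letters e2) -> e1 = e2.
Proof.
have run p e : syllable_form (p :: e) ->
    find (fun x => x.1 != p.1) (flatten (map syl_letters (p :: e))) = `|p.2|%N.
  move=> /andP[/= /andP[p0 e0] pe]; rewrite find_cat has_nseq /= eqxx andbF.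
  rewrite size_nseq; case: e e0 pe => [|q e] /=; first by rewrite addn0.
  by move=> /andP[q0 _] /andP[pq _]; rewrite syl_lettersE //= eq_sym pq addn0.
have nz p e : syllable_form (p :: e) -> p.2 != 0 by case/andP => /andP[].
elim: e1 e2 => [|p e1 IH] [|q e2] // s1 s2.
- by rewrite /= syl_lettersE // (nz _ _ s2).
- by rewrite /= syl_lettersE // (nz _ _ s1).
move=> E; have /= := E; rewrite !syl_lettersE ?(nz _ _ s1) ?(nz _ _ s2) //=.
move=> [pq1 sgn _].
have pq2 : `|p.2|%N = `|q.2|%N by rewrite -(run _ _ s1) E pq1 (run _ _ s2).
have pq : p = q.
  by case: p q pq1 sgn pq2 {s1 s2 E} => i [a|a] [j [b|b]] //= -> _ => [->|[->]].
move: E s1 s2; rewrite -pq /= => /eqP.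
rewrite eqseq_cat // eqxx /= => /eqP E s1 s2.
congr (_ :: _); apply: IH => //.
  by have := @syllable_form_cat2 [:: p] e1 s1 => -[].
by have := @syllable_form_cat2 [:: p] e2 s2 => -[].
Qed.

Lemma syllable_prod_inj e1 e2 : syllable_form e1 -> syllable_form e2 ->
  syllable_prod e1 = syllable_prod e2 -> e1 = e2.
Proof.
move=> s1 s2; rewrite !syllable_prodE => /(congr1 (@word n)).
by rewrite !word_fgw ?reduced_syllables //; exact: flatten_syllables_inj.
Qed.

Variables (lam : 'I_n -> int -> R) (B : R).
Hypotheses (B0 : 0 <= B) (lamB : forall i m, `|lam i m| <= B).
Hypotheses (lamN : forall i m, lam i (- m) = - lam i m).

(** Defined on arbitrary sequences of syllables and not only on normal forms: it is then exactly
    additive under concatenation, and errors arise only from normalising at the junction. *)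
Fixpoint syl_lift e f : R :=
  if e is p :: e' then
    lam p.1 p.2 * ((f (syllable_prod e) + f (syllable_prod e')) / 2)
    + syl_lift e' f
  else 0.

Lemma syl_lift_cat e1 e2 f : syl_lift (e1 ++ e2) f =
  syl_lift e1 (fun x => f (x * syllable_prod e2)%g) + syl_lift e2 f.
Proof.
elim: e1 => [|p e1 IH]; first by rewrite add0r.
by rewrite -addrA -IH /= -cat_cons !syllable_prod_cat.
Qed.

Lemma syl_lift_linear e c f1 f2 :
  syl_lift e (fun x => c * f1 x + f2 x) = c * syl_lift e f1 + syl_lift e f2.
Proof.
elim: e => [|p e IH]; first by rewrite /= mulr0 addr0.
by rewrite /= IH; field.
Qed.

Lemma syl_lift1 e : syl_lift e (fun=> 1) = \sum_(p <- e) lam p.1 p.2.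
Proof.
elim: e => [|p e IH]; first by rewrite big_nil.
by rewrite big_cons /= IH; field.
Qed.

Lemma syllable_form_cat e1 p q e2 :
  syllable_form (rcons e1 p) -> syllable_form (q :: e2) -> p.1 != q.1 ->
  syllable_form (rcons e1 p ++ q :: e2).
Proof.
rewrite /syllable_form all_cat => /andP[-> s1] /andP[/= -> s2] pq.
case: e1 s1 => [|r e1] /=; first by rewrite pq s2.
by rewrite cat_path last_rcons /= pq s2 => ->.
Qed.

Lemma syllable_form_merge e1 i m k l e2 :
  syllable_form (rcons e1 (i, m)) -> syllable_form ((i, k) :: e2) -> l != 0 ->
  syllable_form (rcons e1 (i, l) ++ e2).
Proof.
rewrite /syllable_form all_cat !all_rcons /=.
move=> /andP[/andP[_ ->] s1] /andP[/andP[_ ->] s2] ->.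
have {}s2 : path (fun p q => p.1 != q.1) (i, l) e2 by case: e2 s2.
case: e1 s1 => [|r e1] //=.
by rewrite cat_path !rcons_path last_rcons /= => /andP[-> ->].
Qed.

(** Normalising [e1 ++ e2] cancels opposite syllables at the junction, at no cost, until the meeting
    syllables have different generators, a side is exhausted, or two syllables merge into one.
    Merging happens at most once and exchanges two terms for one, whence the constant [B *+ 3]. *)
Lemma syl_lift_mul e1 e2 f M : syllable_form e1 -> syllable_form e2 ->
  (forall x, `|f x| <= M) ->
  exists e, [/\ syllable_form e,
      syllable_prod e = (syllable_prod e1 * syllable_prod e2)%g &
      `|syl_lift e f - syl_lift e1 (fun x => f (x * syllable_prod e2)%g)
        - syl_lift e2 f| <= B *+ 3 * M].
Proof.
move=> s1 s2 fM; rewrite -syllable_prod_cat.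
have M0 : 0 <= M by apply: le_trans (fM 1%g).
suff [e [eS eE eB]] : exists e, [/\ syllable_form e,
    syllable_prod e = syllable_prod (e1 ++ e2) &
    `|syl_lift e f - syl_lift (e1 ++ e2) f| <= B *+ 3 * M].
  by exists e; split=> //; rewrite -addrA -opprD -syl_lift_cat.
have BM : 0 <= B *+ 3 * M by rewrite mulr_ge0 // mulrn_wge0.
elim/last_ind: e1 e2 s1 s2 => [|e1 [i m] IH] e2 s1 s2.
  by exists e2; split=> //; rewrite subrr normr0.
case: e2 s2 => [|[j k] e2] s2.
  by exists (rcons e1 (i, m)); rewrite cats0; split=> //; rewrite subrr normr0.
have [ij|ij] := eqVneq i j; last first.
  exists (rcons e1 (i, m) ++ (j, k) :: e2); split; rewrite ?subrr ?normr0 //.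
  exact: syllable_form_cat.
rewrite -{j}ij in s2 *.
have prod2 x : (syl (i, m) * (syl (i, k) * x) = syl (i, m + k) * x)%g.
  by rewrite mulgA /syl expgzD.
rewrite cat_rcons.
have [mk|mk] := eqVneq (m + k) 0; last first.
  exists (e1 ++ (i, m + k) :: e2); split.
  - by rewrite -cat_rcons; exact: (syllable_form_merge s1 s2 mk).
  - by rewrite !syllable_prod_cat !syllable_prod_cons prod2.
  rewrite !syl_lift_cat /= !syllable_prod_cons prod2.
  have bnd l u v : `|lam i l * ((f u + f v) / 2)| <= B * M.
    rewrite normrM ler_pM // ler_norml; have := fM u; have := fM v.
    by rewrite !ler_norml => /andP[? ?] /andP[? ?]; apply/andP; split; lra.
  set t1 := lam i (m + k) * _; set t2 := lam i m * _; set t3 := lam i k * _.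
  have := bnd _ _ _ : `|t1| <= B * M; have := bnd _ _ _ : `|t2| <= B * M.
  have := bnd _ _ _ : `|t3| <= B * M.
  rewrite !ler_norml => /andP[? ?] /andP[? ?] /andP[? ?].
  by apply/andP; split; lra.
(* The exponents add up to zero: both syllables disappear and the junction moves inwards. *)
have [||e [eS eE eB]] := IH e2.
- by move: s1; rewrite -cats1 => /syllable_form_cat2[].
- by move: s2; rewrite -cat1s => /syllable_form_cat2[].
have prod0 :
    (syl (i, m) * (syl (i, k) * syllable_prod e2) = syllable_prod e2)%g.
  by rewrite prod2 mk mul1g.
exists e; split=> //.
  by rewrite eE !syllable_prod_cat !syllable_prod_cons prod0.
(* The two cancelling syllables average [f] over the same two points with opposite weights. *)
rewrite (_ : syl_lift (e1 ++ _) f = syl_lift (e1 ++ e2) f) //.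
rewrite !syl_lift_cat /= !syllable_prod_cons prod0; congr (_ + _).
have -> : k = - m by apply/eqP; rewrite -addr_eq0 addrC mk.
by rewrite lamN; ring.
Qed.

Lemma syllable_form_exists (g : F) :
  exists e, syllable_form e /\ g = syllable_prod e.
Proof.
rewrite -(fgwK g); elim: (word g) => [|x s [e [eS eE]]].
  by exists [::]; rewrite fgw_nil /syllable_prod big_nil.
have xS : syllable_form [:: (x.1, if x.2 then -1 else 1 : int)].
  by rewrite /syllable_form /=; case: x.2.
(* Only the normal form is wanted here, so the test function and its bound are taken to be 0. *)
have [|e' [e'S e'E _]] := @syl_lift_mul _ e (fun=> 0) 0 xS eS.
  by move=> ?; rewrite normr0.
exists e'; split=> //; rewrite e'E -eE -cat1s fgw_cat /syllable_prod big_seq1.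
by congr (_ * _)%g; rewrite -/(syl _) sylE; case: x {xS e'E} => i [].
Qed.

Lemma liftable_phi_lambda (phi : F -> R) :
  is_phi_lambda lam phi -> liftable phi.
Proof.
move=> philam.
have /choice[e /all_and2[eS eE]] : forall g : F, exists e,
    syllable_form e /\ g = syllable_prod e by exact: syllable_form_exists.
exists (fun g => syl_lift (e g)); split=> [g c f1 f2|g|].
- exact: syl_lift_linear.
- by rewrite syl_lift1 (philam g (e g)).
exists (B *+ 3) => g h f M fM.
(* By uniqueness of syllable forms, the form produced here is the one chosen for the product. *)
have [e' [e'S e'E]] := syl_lift_mul (eS g) (eS h) fM.
rewrite -!eE in e'E *; congr (`|syl_lift _ f - _ - _| <= _).
by apply: syllable_prod_inj => //; rewrite -eE.
Qed.

End Rolli.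

(** * Counting functions as sums over pairs of cuts *)

Section CountingSum.
Variables (R : realType) (n : nat).
Local Notation F := (freegroup n).
Implicit Types (w g : F).

(** An occurrence starting at cut [k] ends at the single cut [k + size (word w)], which lies beyond
    [k] because [w] is nontrivial. *)
Lemma occurrencesE w g : w <> 1%g -> occurrences w g =
  (\sum_(k < (size (word g)).+1) \sum_(l < (size (word g)).+1)
    ((k < l) && (slice k l (word g) == w)))%N.
Proof.
move=> w1; set s := word g; have rs : reduced s := word_reduced g.
have sw : (0 < size (word w))%N.
  by rewrite lt0n size_eq0; apply/eqP => w0; apply: w1; apply: word_inj.
have dropE k l : (k < l <= size s)%N ->
    drop k s = drop k (take l s) ++ drop l s.
  move=> /andP[kl ls]; have := @slice_cat n s k l (size s).
  by rewrite (ltnW kl) ls leqnn take_size => ->.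
rewrite /occurrences -/s -sum1_count big_mkcond.
rewrite (_ : iota 0 (size s) = index_iota 0 (size s)); last first.
  by rewrite /index_iota subn0.
rewrite big_mkord big_ord_recr /=.
rewrite [X in (_ + X)%N]big1 ?addn0 => [|l _]; last first.
  by rewrite ltnNge -ltnS ltn_ord.
apply: eq_bigr => k _; case: ifP => [/prefixP[t kE]|kF]; last first.
  rewrite big1 // => l _; case: andP => // -[kl /eqP wE]; move: kF.
  rewrite -wE slice_word // (dropE k l) ?prefix_prefix //.
  by rewrite kl -ltnS ltn_ord.
have lN : (k + size (word w) < (size s).+1)%N.
  rewrite ltnS -leq_subRL ?(ltnW (ltn_ord k)) // -size_drop kE size_cat.
  exact: leq_addr.
rewrite (bigD1 (Ordinal lN)) //= big1 => [|l ll].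
  rewrite addn0 -{1}(addn0 k) ltn_add2l sw.
  rewrite -(inj_eq (@word_inj n)) slice_word //.
  rewrite addnC -take_drop kE take_size_cat ?eqxx //.
case: andP => // -[kl /eqP wE]; case/eqP: ll; apply: val_inj => /=.
rewrite -wE slice_word // size_drop size_takel ?subnKC //; first exact: ltnW.
by rewrite -ltnS.
Qed.

Lemma h_countE w g : w <> 1%g -> h_count R w g =
  \sum_(k < (size (word g)).+1) \sum_(l < (size (word g)).+1)
    if (k < l)%N then
      (slice k l (word g) == w)%:R - (slice k l (word g) == w^-1%g)%:R
    else 0.
Proof.
move=> w1; have w1' : w^-1%g <> 1%g by rewrite -invg1 => /invg_inj.
rewrite /h_count !occurrencesE // !natr_sum -sumrB; apply: eq_bigr => k _.
rewrite !natr_sum -sumrB; apply: eq_bigr => l _.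
by case: ifP => //; rewrite subrr.
Qed.

(** After exchanging the sums, a piece [u] contributes [alpha u]: through [w = u] if [u] is in [Np],
    and through its inverse otherwise, where the signs of [h_count] and of [alpha] cancel. *)
Lemma phi_alphaE (Np : set F) (alpha : F -> R) g : is_Nplus Np ->
  (forall w, alpha w^-1%g = - alpha w) ->
  (forall w, alpha w <> 0 -> non_self_overlapping w) ->
  phi_alpha Np alpha g = ind_lift alpha (word g) (fun=> 1).
Proof.
move=> [Np1 Np2] aV aN; set s := word g; set N := (size s).+1.
pose S := [seq slice k l s | k <- iota 0 N, l <- iota 0 N].
have sliceS (k l : 'I_N) : slice k l s \in S.
  by apply/allpairsP; exists (val k, val l); rewrite !mem_iota !ltn_ord.
(* A finite list containing every word of [Np] whose count on [g] can be nonzero, which turns the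
   sum over [Np] into a finite one. *)
pose r := [seq w <- undup (S ++ [seq w^-1%g | w <- S]) | w \in Np].
have rE w : (w \in r) = (w \in Np) && ((w \in S) || (w^-1%g \in S)).
  rewrite mem_filter mem_undup mem_cat -{3}(invgK w).
  by rewrite (mem_map (@invg_inj F)).
have r_uniq : uniq r by rewrite filter_uniq // undup_uniq.
rewrite /phi_alpha (@fsbigE _ _ _ _ _ r) //; first last.
- move=> w Npw; rewrite rE mem_set //= negb_or => /andP[wS wS'].
  rewrite h_countE; last by case: (Np1 _ Npw).
  rewrite big1 ?mulr0 // => k _; rewrite big1 // => l _; case: ifP => // _.
  rewrite (negPf (memPn wS _ (sliceS k l))) (negPf (memPn wS' _ (sliceS k l))).
  by rewrite subrr.
- by move=> w /=; rewrite rE => /andP[/set_mem].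
have a1 : alpha 1%g = 0.
  have := aV 1%g; rewrite invg1 => /eqP.
  by rewrite -subr_eq0 opprK -mulr2n mulrn_eq0 => /eqP.
rewrite big_seq_cond (eq_bigl (fun w => w \in r)) => [|w /=]; last first.
  by rewrite andb_idr // rE => /andP[].
rewrite (eq_bigr (fun w => \sum_(k < N) \sum_(l < N) if (k < l)%N then
    alpha w * ((slice k l s == w)%:R - (slice k l s == w^-1%g)%:R)
  else 0)); last first.
  move=> w; rewrite rE => /andP[/set_mem Npw _].
  rewrite h_countE ?mulr_sumr; last by case: (Np1 _ Npw).
  apply: eq_bigr => k _; rewrite mulr_sumr; apply: eq_bigr => l _.
  by case: ifP; rewrite ?mulr0.
rewrite -big_seq exchange_big; apply: eq_bigr => k _.
rewrite exchange_big; apply: eq_bigr => l _ /=; rewrite /ind_term.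
case: ifP => kl; last by rewrite big1.
have -> : (1 + 1) / 2 = 1 :> R by field.
set u := slice k l s; rewrite mulr1.
have pick v : \sum_(w <- r) alpha w * (v == w)%:R = (v \in r)%:R * alpha v.
  have [vr|vr] := boolP (v \in r); last first.
    rewrite mul0r big1_seq // => w /= wr.
    by case: eqP vr => [->|]; rewrite ?wr ?mulr0.
  rewrite mul1r (bigD1_seq v) //= eqxx mulr1 big1 ?addr0 // => w.
  by rewrite eq_sym => /negPf ->; rewrite mulr0.
under eq_bigr do rewrite mulrBr.
rewrite sumrB pick.
rewrite (eq_bigr (fun w => alpha w * (u^-1%g == w)%:R)) => [|w _]; last first.
  by rewrite -(inj_eq (@invg_inj F) u^-1%g) invgK.
have uS : u \in S by exact: sliceS.
rewrite pick aV !rE invgK uS orbT !andbT.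
have [->|/eqP au] := eqVneq (alpha u) 0; first by rewrite oppr0 !mulr0 subr0.
have u1 : u <> 1%g by move=> u1; apply: au; rewrite u1.
(* A piece of nonzero weight is nontrivial and non-self-overlapping, so exactly one of [u] and its
   inverse is in [Np]. *)
have [[Npu|Npu] Npu2] := Np2 u (aN u au) u1.
  rewrite mem_set // memNset => [|Npu']; last exact: Npu2.
  by rewrite mul1r mul0r subr0.
rewrite (mem_set Npu) memNset => [|Npu']; last exact: Npu2.
by rewrite mul1r mul0r sub0r opprK.
Qed.

End CountingSum.

(** * Liftability of both classes of quasimorphisms, and vanishing of the cup product *)

Lemma liftable_Sigma_Ind (R : realType) (n : nat) (Np : set (freegroup n))
    (phi : freegroup n -> R) : is_Nplus Np -> Sigma_Ind Np phi -> liftable phi.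
Proof.
move=> hNp [k [a [I [aP ->]]]].
(* [ind_lift] is additive in the weight, so the total weight splits into the [a i], each supported
   on its own independent family. *)
have -> : phi_alpha Np (fun w => \sum_i a i w) =
    fun g => \sum_i ind_lift (a i) (word g) (fun=> 1).
  apply/funext => g; rewrite phi_alphaE //.
  - rewrite /ind_lift [RHS]exchange_big; apply: eq_bigr => p _ /=.
    rewrite [RHS]exchange_big; apply: eq_bigr => q _ /=.
    rewrite /ind_term; case: ifP => _; last by rewrite big1.
    by rewrite mulr_suml.
  - by move=> w; rewrite -sumrN; apply: eq_bigr => i _; case: (aP i).
  (* A word of nonzero total weight lies in some [I i]; independence applied to the pair [w, w]
     shows that it does not overlap itself. *)
  move=> w aw; have [i aiw] : exists i, a i w <> 0.
    apply: contrapT => a0; apply: aw; rewrite big1 // => i _.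
    by apply: contrapT => aiw; apply: a0; exists i.
  by case: (aP i) => _ _ /(_ w aiw) Iw _ /(_ w w Iw Iw).
apply: liftable_sum => i; case: (aP i) => -[B aB] aV aI _ indI.
exact: liftable_ind aB aV aI indI.
Qed.

Lemma liftable_Rolli (R : realType) (n : nat) (phi : freegroup n -> R) :
  Rolli phi -> liftable phi.
Proof.
move=> [lam [/all_and2[/choice[B lamB] lamN] philam]].
(* The bounds [B i] of the finitely many [lam i] are merged into one uniform bound. *)
apply: (@liftable_phi_lambda _ _ lam (\sum_i `|B i|)) philam => //.
- exact: sumr_ge0.
- move=> i m; apply: le_trans (lamB i m) _; apply: le_trans (ler_norm _) _.
  by rewrite (bigD1 i) //= lerDl sumr_ge0.
Qed.

Theorem theorem1p13 (R : realType) (n : nat) (hn : (1 < n)%N)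
    (P : groupType) (i1 i2 : {multiplicative freegroup n -> P})
    (hP : is_free_product i1 i2)
    (Np : set (freegroup n)) (hNp : is_Nplus Np)
    (hyp : forall (phi' psi' : P -> R)
        (qphi' : quasimorphism phi') (qpsi' : quasimorphism psi'),
      hcup (dclass qphi') (dclass qpsi') = 0 :> Hb R P 4 ->
      hcup (dclass (quasimorphism_diag i1 i2 qphi'))
           (dclass (quasimorphism_diag i1 i2 qpsi')) = 0 :> Hb R (freegroup n) 4)
    (phi psi : freegroup n -> R)
    (hphi : Sigma_Ind Np phi \/ Rolli phi) (qpsi : quasimorphism psi) :
  exists qphi : quasimorphism phi,
    hcup (dclass qphi) (dclass qpsi) = 0 :> Hb R (freegroup n) 4.
Proof.
have Lphi : liftable phi.
  by case: hphi => [/(liftable_Sigma_Ind hNp)|/liftable_Rolli].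
exists (liftable_quasimorphism Lphi).
(* [hcupE] passes from classes to the cup product of the representing cocycles, for which
   [cup_liftable] supplies a bounded primitive. *)
by rewrite hcupE; apply/bclass_eq0; exact: cup_liftable.
Qed.
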